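(* Let $\mathbf C$ be a topological category, $G$ a topologised group in $\mathbf C$, $H\le G$ a topologised subgroup admitting a morphism ${}_H(-):G\to H$ in $\mathbf C$ with ${}_H(1)=1$ and ${}_H(hg)=h\cdot{}_H(g)$ for all $h\in\mathfrak zH,g\in\mathfrak zG$, and let $D$ be a discrete abelian monoid in $\mathbf C$. Let $(A,h_A)$ be a $D\times H$-module with $\mathbf C$-rigidification such that $D$ is $A$-pliant. Then $$C^\bullet(D\times G,\mathrm{Ind}_G^H(A))\cong C^\bullet(D\times H,A)$$ in the derived category of abelian groups.
   Context: A concrete category is a category with a faithful functor $\mathfrak z:\mathbf C\to\mathbf{Set}$; it admits discrete objects if it has finite limits and $\mathfrak z$ has a fully faithful left adjoint $\mathbf F$. An object $X$ is discrete if $\mathfrak z:\mathrm{Hom}(X,Y)\to\mathrm{Hom}_{\mathbf{Set}}(\mathfrak zX,\mathfrak zY)$ is bijective for all $Y$. $\bullet$ is a one-point set. $\mathbf C$ is topological if $\mathbf F$ commutes with finite limits and for every discrete $D$ and all $X,Y$ the natural map $\mathrm{Hom}(D\times X,Y)\to\mathrm{Hom}_{\mathbf{Set}}(\mathfrak zD,\mathrm{Hom}(X,Y))$ is bijective. Topologised groups/monoids are group/monoid objects in $\mathbf C$; a topologised subgroup $H\le G$ is a monomorphism of topologised groups $H\to G$, through which $\mathfrak zH\subseteq\mathfrak zG$. A $K$-module with $\mathbf C$-rigidification is a pair $(A,h_A)$ of an abelian group $A$ with $\mathfrak zK$-module structure and a functor $h_A:\mathbf C^{\mathrm{op}}\to\mathbf{Set}$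 with $h_A(X)$ a subgroup of $\mathrm{Hom}_{\mathbf{Set}}(\mathfrak zX,A)$ functorially in $X$, $h_A(\mathbf F\bullet)=A$, such that for $f\in h_A(X)$ the map $(k,x)\mapsto k\cdot f(x)$ lies in $h_A(K\times X)$. A discrete $D$ is $A$-pliant if $h_A(D\times X)=\mathrm{Hom}_{\mathbf{Set}}(\mathfrak zD,h_A(X))$ for all $X$. $\mathrm{Ind}_G^H(A)$ is the functor $X\mapsto\{f\in h_A(X\times G): f(x,hg)=h\cdot f(x,g)\ \forall x,h\in\mathfrak zH,g\}$; $\mathfrak zG$ acts on $\mathrm{Ind}_G^H(A)(\mathbf F\bullet)\subseteq h_A(G)$ by $(gf)(\sigma)=f(\sigma g)$ and $\mathfrak zD$ acts by $(df)(\sigma)=d\cdot f(\sigma)$, making it a $D\times G$-module with $\mathbf C$-rigidification. $C^n(K,B)$ denotes normalised cochains: $f\in h_B(K^n)$ vanishing whenever some argument equals $1$, with differential $\partial f(x_1,\dots,x_{n+1})=x_1f(x_2,\dots,x_{n+1})+\sum_{i=1}^n(-1)^if(\dots,x_ix_{i+1},\dots)+(-1)^{n+1}f(x_1,\dots,x_n)$. *)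

(* Defs.v *)
From HB Require Import structures.
From mathcomp Require Import all_boot all_algebra.
From mathcomp Require Import boolp classical_sets functions.

Set Implicit Arguments.
Unset Strict Implicit.
Unset Printing Implicit Defensive.
Import GRing.Theory.
Local Open Scope ring_scope.

(* Universal properties, for a concrete category presented by its      *)
(* objects O, its faithful functor cr : O -> Type (the functor z) and   *)
(* the predicate M telling which functions are (images of) morphisms.   *)
Section Univ.
Variables (O : Type) (cr : O -> Type) (M : forall X Y : O, (cr X -> cr Y) -> Prop).

Definition is_terminal (T : O) :=
  forall Y : O, exists f : cr Y -> cr T, M f /\
    forall g : cr Y -> cr T, M g -> forall y, g y = f y.

Definition is_product (X Y P : O) (p1 : cr P -> cr X) (p2 : cr P -> cr Y) :=
  M p1 /\ M p2 /\
  forall (W : O) (f : cr W -> cr X) (g : cr W -> cr Y), M f -> M g ->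
    exists h : cr W -> cr P, M h /\ (forall w, p1 (h w) = f w /\ p2 (h w) = g w) /\
      forall h' : cr W -> cr P, M h' ->
        (forall w, p1 (h' w) = f w /\ p2 (h' w) = g w) -> forall w, h' w = h w.

Definition is_equalizer (X Y E : O) (f g : cr X -> cr Y) (e : cr E -> cr X) :=
  M e /\ (forall x, f (e x) = g (e x)) /\
  forall (W : O) (k : cr W -> cr X), M k -> (forall w, f (k w) = g (k w)) ->
    exists h : cr W -> cr E, M h /\ (forall w, e (h w) = k w) /\
      forall h' : cr W -> cr E, M h' -> (forall w, e (h' w) = k w) -> forall w, h' w = h w.
End Univ.

(* A concrete category (C, z) with chosen finite limits (terminal      *)
(* object, binary products, equalizers).  Hom(X,Y) is identified with   *)
(* its (injective, z being faithful) image in functions zX -> zY.       *)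
Record ConcCat := {
  Ob : Type;
  carr : Ob -> Type;
  isMor : forall X Y : Ob, (carr X -> carr Y) -> Prop;
  mor_id : forall X : Ob, @isMor X X (fun x => x);
  mor_comp : forall (X Y Z : Ob) (f : carr X -> carr Y) (g : carr Y -> carr Z),
      isMor f -> isMor g -> isMor (fun x => g (f x));
  term : Ob;
  term_univ : is_terminal isMor term;
  prod : Ob -> Ob -> Ob;
  pr1 : forall X Y : Ob, carr (prod X Y) -> carr X;
  pr2 : forall X Y : Ob, carr (prod X Y) -> carr Y;
  prod_univ : forall X Y : Ob, is_product isMor (@pr1 X Y) (@pr2 X Y);
  eqz : forall X Y : Ob, (carr X -> carr Y) -> (carr X -> carr Y) -> Ob;
  eqz_incl : forall (X Y : Ob) (f g : carr X -> carr Y), carr (@eqz X Y f g) -> carr X;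
  eqz_univ : forall (X Y : Ob) (f g : carr X -> carr Y), isMor f -> isMor g ->
      is_equalizer isMor f g (@eqz_incl X Y f g)
}.
Arguments isMor {c X Y}.
Arguments term {c}.
Arguments prod {c}.
Arguments pr1 {c X Y}.
Arguments pr2 {c X Y}.

Section Cat.
Variable C : ConcCat.
Local Notation Ob := (Ob C).
Local Notation carr := (@carr C).

Record LeftAdj := {
  Fo : Type -> Ob;
  eta : forall S : Type, S -> carr (Fo S);
  eta_univ : forall (S : Type) (Y : Ob) (f : S -> carr Y),
      exists g : carr (Fo S) -> carr Y, isMor g /\ (forall s, g (eta s) = f s) /\
        forall g' : carr (Fo S) -> carr Y, isMor g' -> (forall s, g' (eta s) = f s) ->
          forall y, g' y = g y
}.

Variable F : LeftAdj.

Definition Fmap_of (S S' : Type) (f : S -> S') (phi : carr (Fo F S) -> carr (Fo F S')) :=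
  isMor phi /\ forall s, phi (eta F s) = eta F (f s).

Definition fully_faithful :=
  forall (S S' : Type) (phi : carr (Fo F S) -> carr (Fo F S')), isMor phi ->
    exists! f : S -> S', forall s, phi (eta F s) = eta F (f s).

Definition F_lex :=
  is_terminal (@isMor C) (Fo F unit) /\
  (forall (S S' : Type) q1 q2, Fmap_of (@fst S S') q1 -> Fmap_of (@snd S S') q2 ->
      is_product (@isMor C) q1 q2) /\
  (forall (S S' : Type) (f g : S -> S') phi psi e,
      Fmap_of f phi -> Fmap_of g psi ->
      Fmap_of (fun x : {s : S | f s = g s} => sval x) e ->
      is_equalizer (@isMor C) phi psi e).

(* X is discrete: z : Hom(X,Y) -> Hom_Set(zX,zY) is bijective
   (injectivity is automatic, z being faithful). *)
Definition discrete (X : Ob) := forall (Y : Ob) (f : carr X -> carr Y), isMor f.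

Definition topological :=
  fully_faithful /\ F_lex /\
  forall (D X Y : Ob), discrete D ->
    forall phi : carr D -> carr X -> carr Y, (forall d, isMor (phi d)) ->
      let nat_image (f : carr (prod D X) -> carr Y) :=
        forall (d : carr D) (u : carr X -> carr (prod D X)), isMor u ->
          (forall x, pr1 (u x) = d /\ pr2 (u x) = x) -> forall x, f (u x) = phi d x in
      exists f : carr (prod D X) -> carr Y, isMor f /\ nat_image f /\
        forall f', isMor f' -> nat_image f' -> forall p, f' p = f p.

(* Topologised groups and monoids: group/monoid objects of C, presented
   concretely (operations on the underlying set that are morphisms). *)
Record TopGroup := {
  gob : Ob;
  gmul : carr gob -> carr gob -> carr gob;
  gone : carr gob;
  ginv : carr gob -> carr gob;
  gmulA : forall x y z, gmul x (gmul y z) = gmul (gmul x y) z;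
  gmul1l : forall x, gmul gone x = x;
  gmul1r : forall x, gmul x gone = x;
  gmulVl : forall x, gmul (ginv x) x = gone;
  gmulVr : forall x, gmul x (ginv x) = gone;
  gmul_mor : @isMor C (prod gob gob) gob (fun p => gmul (pr1 p) (pr2 p));
  ginv_mor : isMor ginv;
  gone_mor : @isMor C term gob (fun _ => gone)
}.

Record TopMonoid := {
  mob : Ob;
  mmul : carr mob -> carr mob -> carr mob;
  mone : carr mob;
  mmulA : forall x y z, mmul x (mmul y z) = mmul (mmul x y) z;
  mmul1l : forall x, mmul mone x = x;
  mmul1r : forall x, mmul x mone = x;
  mmul_mor : @isMor C (prod mob mob) mob (fun p => mmul (pr1 p) (pr2 p));
  mone_mor : @isMor C term mob (fun _ => mone)
}.

(* H <= G : a monomorphism of topologised groups (a morphism of C which is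
   a group homomorphism and a monomorphism); zH is viewed inside zG via i. *)
Definition topo_subgroup (H G : TopGroup) (i : carr (gob H) -> carr (gob G)) :=
  isMor i /\ (forall x y, i (gmul x y) = gmul (i x) (i y)) /\
  forall (W : Ob) (a b : carr W -> carr (gob H)), isMor a -> isMor b ->
    (forall w, i (a w) = i (b w)) -> forall w, a w = b w.

Definition H_retraction (H G : TopGroup) (i : carr (gob H) -> carr (gob G))
    (r : carr (gob G) -> carr (gob H)) :=
  isMor r /\ r (gone G) = gone H /\ forall h g, r (gmul (i h) g) = gmul h (r g).

(* zK = z(D x H) is identified with zD * zH (z preserves products). *)
Definition pair_mul (T1 T2 : Type) (m1 : T1 -> T1 -> T1) (m2 : T2 -> T2 -> T2)
  (x y : T1 * T2) : T1 * T2 := (m1 x.1 y.1, m2 x.2 y.2).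

Definition monoid_action (T : Type) (mul : T -> T -> T) (one : T) (A : zmodType)
    (act : T -> A -> A) :=
  (forall a, act one a = a) /\ (forall k k' a, act (mul k k') a = act k (act k' a)) /\
  (forall k a b, act k (a + b) = act k a + act k b).

(* h_A : X |-> subgroup of Hom_Set(zX, A), functorial, h_A(F(pt)) = A. *)
Definition rigidification (A : zmodType) (hA : forall X : Ob, (carr X -> A) -> Prop) :=
  (forall X, hA X (fun _ => 0)) /\
  (forall X f g, hA X f -> hA X g -> hA X (fun x => f x - g x)) /\
  (forall (X Y : Ob) (u : carr X -> carr Y), isMor u ->
      forall f, hA Y f -> hA X (fun x => f (u x))) /\
  (forall f : carr (Fo F unit) -> A, hA (Fo F unit) f).

Definition rigid_action (K1 K2 : Ob) (A : zmodType) (act : carr K1 * carr K2 -> A -> A)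
    (hA : forall X : Ob, (carr X -> A) -> Prop) :=
  forall (X : Ob) f, hA X f ->
    hA (prod (prod K1 K2) X) (fun q => act (pr1 (pr1 q), pr2 (pr1 q)) (f (pr2 q))).

Definition module_rigid (K1 K2 : Ob) (m1 : carr K1 -> carr K1 -> carr K1) (e1 : carr K1)
    (m2 : carr K2 -> carr K2 -> carr K2) (e2 : carr K2)
    (A : zmodType) (act : carr K1 * carr K2 -> A -> A) (hA : forall X : Ob, (carr X -> A) -> Prop) :=
  monoid_action (pair_mul m1 m2) (e1, e2) act /\ rigidification hA /\ rigid_action act hA.

(* D is A-pliant: h_A(D x X) = Hom_Set(zD, h_A(X)) *)
Definition pliant (Dob : Ob) (A : zmodType) (hA : forall X : Ob, (carr X -> A) -> Prop) :=
  forall (X : Ob) (phi : carr (prod Dob X) -> A),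
    hA (prod Dob X) phi <->
    forall d : carr Dob, exists psi : carr X -> A, hA X psi /\
      forall q, pr1 q = d -> phi q = psi (pr2 q).

Section Ind.
Variables (G H : TopGroup) (i : carr (gob H) -> carr (gob G)) (D : TopMonoid)
  (A : zmodType) (act : carr (mob D) * carr (gob H) -> A -> A)
  (hA : forall X : Ob, (carr X -> A) -> Prop).

Definition IndH (X : Ob) (f : carr (prod X (gob G)) -> A) :=
  @hA (prod X (gob G)) f /\
  forall q q' (h : carr (gob H)), pr1 q' = pr1 q -> pr2 q' = gmul (i h) (pr2 q) ->
    f q' = act (mone D, h) (f q).

(* B := Ind_G^H(A)(F(pt)), viewed inside Hom(zG, A) via pr2 : F(pt) x G ~ G *)
Definition IndB (b : carr (gob G) -> A) := IndH (fun q => b (@pr2 C (Fo F unit) _ q)).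

Definition hInd (X : Ob) (phi : carr X -> (carr (gob G) -> A)) :=
  (forall x, IndB (phi x)) /\ IndH (fun q => phi (pr1 q) (pr2 q)).

Definition actInd (k : carr (mob D) * carr (gob G)) (b : carr (gob G) -> A) :
  carr (gob G) -> A := fun sigma => act (k.1, gone H) (b (gmul sigma k.2)).
End Ind.

Fixpoint powK (K : Ob) (n : nat) : Ob :=
  match n with 0 => term | m.+1 => prod K (powK K m) end.

Fixpoint coords (K1 K2 : Ob) (n : nat) :
    carr (powK (prod K1 K2) n) -> n.-tuple (carr K1 * carr K2) :=
  match n return carr (powK (prod K1 K2) n) -> n.-tuple (carr K1 * carr K2) with
  | 0 => fun _ => [tuple]
  | m.+1 => fun p => cons_tuple (pr1 (pr1 p), pr2 (pr1 p)) (@coords K1 K2 m (pr2 p))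
  end.
End Cat.

Section Cochains.
Variables (T : Type) (tmul : T -> T -> T) (tone : T) (B : zmodType) (act : T -> B -> B).

Definition face0 n (x : n.+1.-tuple T) : n.-tuple T := [tuple nth tone x j.+1 | j < n].
Definition facem n (i : nat) (x : n.+1.-tuple T) : n.-tuple T :=
  [tuple (if (j < i)%N then nth tone x j
          else if (j == i :> nat) then tmul (nth tone x i) (nth tone x i.+1)
          else nth tone x j.+1) | j < n].
Definition facel n (x : n.+1.-tuple T) : n.-tuple T := [tuple nth tone x j | j < n].
Definition sgn (k : nat) (v : B) := if odd k then - v else v.

Definition cobound n (f : n.-tuple T -> B) : n.+1.-tuple T -> B := fun x =>
  act (nth tone x 0) (f (face0 x)) + \sum_(i < n) sgn i.+1 (f (facem i x))
  + sgn n.+1 (f (facel x)).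

Definition normalised n (f : n.-tuple T -> B) :=
  forall t : n.-tuple T, (exists j : 'I_n, tnth t j = tone) -> f t = 0.
End Cochains.

(* A (raw) cochain complex of abelian groups in degrees >= 0: the groups are
   the subgroups cS n of ambient groups cV n, with differentials cd n. *)
Record rawcx := {
  cV : nat -> zmodType;
  cS : forall n, cV n -> Prop;
  cd : forall n, cV n -> cV n.+1
}.
Arguments cS : clear implicits.
Arguments cd : clear implicits.

Definition is_complex (X : rawcx) := forall n,
  cS X n 0 /\ (forall x y, cS X n x -> cS X n y -> cS X n (x + y)) /\
  (forall x, cS X n x -> cS X n (- x)) /\
  (forall x y, cS X n x -> cS X n y -> cd X n (x + y) = cd X n x + cd X n y) /\
  (forall x, cS X n x -> cS X n.+1 (cd X n x)) /\
  (forall x, cS X n x -> cd X n.+1 (cd X n x) = 0).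

Definition chain_map (X Y : rawcx) (f : forall n, cV X n -> cV Y n) := forall n,
  (forall x y, cS X n x -> cS X n y -> f n (x + y) = f n x + f n y) /\
  (forall x, cS X n x -> cS Y n (f n x)) /\
  (forall x, cS X n x -> f n.+1 (cd X n x) = cd Y n (f n x)).

Definition is_bd (X : rawcx) (n : nat) : cV X n -> Prop :=
  match n return cV X n -> Prop with
  | 0 => fun y => y = 0
  | m.+1 => fun y => exists w, cS X m w /\ y = cd X m w
  end.

Definition quasi_iso (X Y : rawcx) (f : forall n, cV X n -> cV Y n) :=
  chain_map f /\ forall n,
  (forall x, cS X n x -> cd X n x = 0 -> is_bd (f n x) -> is_bd x) /\
  (forall y, cS Y n y -> cd Y n y = 0 ->
     exists x, cS X n x /\ cd X n x = 0 /\ is_bd (y - f n x)).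

(* X ~ Y in the derived category of abelian groups: a roof of quasi-isos *)
Definition derived_iso (X Y : rawcx) :=
  exists Z : rawcx, is_complex Z /\
    exists (f : forall n, cV Z n -> cV X n) (g : forall n, cV Z n -> cV Y n),
      quasi_iso f /\ quasi_iso g.

(* C^.(K,B): normalised cochains; rig n f says f (transported along
   z(K^n) ~ (zK)^n) lies in h_B(K^n). *)
Definition cochain_cx (T : Type) (tmul : T -> T -> T) (tone : T) (B : zmodType)
    (act : T -> B -> B) (rig : forall n, (n.-tuple T -> B) -> Prop) : rawcx :=
  {| cV := fun n => (n.-tuple T -> B : zmodType);
     cS := fun n f => rig n f /\ normalised tone f;
     cd := fun n f => cobound tmul tone act f |}.

Definition cx_Ind (C : ConcCat) (F : LeftAdj C) (G H : TopGroup C)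
    (i : carr (gob H) -> carr (gob G)) (D : TopMonoid C) (A : zmodType)
    (act : carr (mob D) * carr (gob H) -> A -> A) (hA : forall X : Ob C, (carr X -> A) -> Prop)
    : rawcx :=
  @cochain_cx (carr (mob D) * carr (gob G)) (pair_mul (@mmul C D) (@gmul C G))
    (mone D, gone G) (carr (gob G) -> A : zmodType) (actInd act)
    (fun n f => hInd F i act hA (fun p => f (@coords C (mob D) (gob G) n p))).

Definition cx_A (C : ConcCat) (H : TopGroup C) (D : TopMonoid C) (A : zmodType)
    (act : carr (mob D) * carr (gob H) -> A -> A) (hA : forall X : Ob C, (carr X -> A) -> Prop)
    : rawcx :=
  @cochain_cx (carr (mob D) * carr (gob H)) (pair_mul (@mmul C D) (@gmul C H))
    (mone D, gone H) A act
    (fun n f => hA _ (fun p => f (@coords C (mob D) (gob H) n p))).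

(* Main.v *)
(** Work in mixed homogeneous coordinates: a cochain [f] of [D x G] with values
    in the induced module becomes the function
      [(c, d) |-> f ((d_0, c_0^-1 c_1), ..., (d_(n-1), c_(n-1)^-1 c_n)) (c_0)]
    of vertices [c_k] in [G] and labels [d_k] in [D], and a cochain [f] of
    [D x H] with values in [A] becomes
      [(c, d) |-> c_0 . f ((d_0, c_0^-1 c_1), ...)] with vertices in [H].
    Both are exactly the normalised, rigid, [H]-equivariant functions of
    [(c, d)], and in both cases the [i]-th face omits [c_i] and multiplies
    [d_(i-1)] with [d_i] (the 0-th face lets [d_0] act). Restriction along
    [H -> G] and pullback along the retraction [r : G -> H] are then chain
    maps between the two complexes. One composite is the identity; the other
    is homotopic to it by the prism operators
    [(c_0, ..., c_j, r c_j, ..., r c_n)], with label [1] inserted at [j]. *)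

Require Import Defs.
From HB Require Import structures.
From mathcomp Require Import all_boot all_algebra.
From mathcomp Require Import zify.
From mathcomp Require Import boolp classical_sets functions.

Set Implicit Arguments.
Unset Strict Implicit.
Unset Printing Implicit Defensive.
Import GRing.Theory.
Local Open Scope ring_scope.

(** * Alternating sums *)

Section AlternatingSums.
Variable V : zmodType.
Implicit Types v w : V.

Lemma sgnS k v : sgn k.+1 v = - sgn k v.
Proof. by rewrite /sgn /=; case: odd; rewrite ?opprK. Qed.

Lemma sgn_sgn j k v : sgn j (sgn k v) = sgn (j + k) v.
Proof. by elim: j => //= j IH; rewrite addSn !sgnS IH. Qed.

Lemma sgn_sum I (s : seq I) k (E : I -> V) :
  sgn k (\sum_(j <- s) E j) = \sum_(j <- s) sgn k (E j).
Proof. by rewrite /sgn; case: odd; rewrite // sumrN. Qed.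

Lemma sgn0 k : sgn k (0 : V) = 0.
Proof. by rewrite /sgn; case: odd; rewrite ?oppr0. Qed.

Lemma sgnD k v w : sgn k (v + w) = sgn k v + sgn k w.
Proof. by rewrite /sgn; case: odd; rewrite ?opprD. Qed.

(** The positions [(j, i)] with [i < j] and [(i, j - 1)] carry equal entries and opposite signs. In
    the step from [N] to [N + 1] the new row [j = N + 1] cancels the new column [i = N]. *)
Lemma simplicial_sum0 N (a : nat -> nat -> V) :
  (forall i j, (i < j <= N)%N -> a j i = a i j.-1) ->
  \sum_(j < N.+1) \sum_(i < N) sgn (j + i) (a j i) = 0.
Proof.
elim: N => [|N IH] H; first by rewrite big1 // => j _; rewrite big_ord0.
rewrite big_ord_recr /=; under eq_bigr do rewrite big_ord_recr /=.
rewrite big_split /= IH => [|i j Hij]; last by apply: H; lia.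
rewrite add0r -big_split big1 //= => i _.
rewrite [a N.+1 i]H /=; last by have := ltn_ord i; lia.
by rewrite addSn sgnS addnC addrN.
Qed.

(** Think of [b j i] as the [i]-th face of the [j]-th prism and of [c i j] as the [j]-th prism over
    the [i]-th face. Away from [i = j] and [i = j + 1] the two sums cancel; on these two diagonals
    the third hypothesis makes the sum telescope. *)
Lemma prism_sum n (b c : nat -> nat -> V) :
  (forall i j, (i < j <= n)%N -> b j i = c i j.-1) ->
  (forall i j, (j.+1 < i <= n.+1)%N -> b j i = c i.-1 j) ->
  (forall j, (j < n)%N -> b j.+1 j.+1 = b j j.+1) ->
  \sum_(j < n.+1) \sum_(i < n.+2) sgn (j + i) (b j i) +
  \sum_(i < n.+1) \sum_(j < n) sgn (i + j) (c i j) = b 0%N 0%N - b n n.+1.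
Proof.
elim: n => [|n IH] H1 H2 H3.
  by rewrite !big_ord1 big_ord0 addr0 !big_ord_recr big_ord0 /= add0r.
pose S1 := \sum_(j < n.+1) \sum_(i < n.+2) sgn (j + i) (b j i).
pose S2 := \sum_(i < n.+1) \sum_(j < n) sgn (i + j) (c i j).
have IHn : S1 + S2 = b 0%N 0%N - b n n.+1.
  by apply: IH => [i j Hij|i j Hij|j Hj]; [apply: H1|apply: H2|apply: H3]; lia.
rewrite big_ord_recr /=; under eq_bigr do rewrite big_ord_recr /=.
rewrite big_split /= -/S1 [\sum_(i < n.+3) _]big_ord_recr big_ord_recr /=.
rewrite [X in _ + X]big_ord_recr /=.
under [\sum_(i < n.+1) \sum_(j < n.+1) _]eq_bigr do rewrite big_ord_recr /=.
rewrite big_split /= -/S2.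
have -> : \sum_(j < n.+1) sgn (j + n.+2) (b j n.+2) =
    - \sum_(i < n.+1) sgn (n.+1 + i) (c n.+1 i).
  rewrite -sumrN; apply: eq_bigr => j _; rewrite H2 /=; last by have := ltn_ord j; lia.
  by rewrite addnS sgnS addnC.
have -> : \sum_(i < n.+1) sgn (n.+1 + i) (b n.+1 i) =
    - \sum_(i < n.+1) sgn (i + n) (c i n).
  rewrite -sumrN; apply: eq_bigr => j _; rewrite H1 /=; last by have := ltn_ord j; lia.
  by rewrite addSn sgnS addnC.
have -> : sgn (n.+1 + n.+1) (b n.+1 n.+1) = b n n.+1.
  by rewrite H3 // /sgn oddD addbb.
have -> : sgn (n.+1 + n.+2) (b n.+1 n.+2) = - b n.+1 n.+2.
  by rewrite /sgn oddD /= addbN addbb.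
set X := \sum_(_ < _) _; set Y := \sum_(_ < _) _.
(* The four border sums cancel in pairs, leaving the induction hypothesis and the next telescoping
   term [b n n.+1 - b n.+1 n.+2]. *)
rewrite [LHS](AC (2*3*3) ((1*6)*(4*5)*(3*7)*(2*8))) /= !addNr !addr0 IHn.
by rewrite addrA subrK.
Qed.
End AlternatingSums.

(** * Face and prism operators in homogeneous coordinates *)

Section Operators.
Variables (Gam E : Type) (mul : E -> E -> E) (one : E).
Hypothesis mulA : forall x y z, mul x (mul y z) = mul (mul x y) z.
Hypothesis mul1l : forall x, mul one x = x.
Hypothesis mul1r : forall x, mul x one = x.
Implicit Types (c : nat -> Gam) (d : nat -> E).

Local Ltac congr_lia := first [reflexivity | lia | progress f_equal; congr_lia].
Local Ltac reindex := repeat case: ifP; move=> *;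
  first [exfalso; lia | rewrite -?mulA ?mul1l ?mul1r; congr_lia].

(** Vertices and labels form infinite sequences, so faces and prisms are total and carry no
    dependent lengths; the predicate [local] restores the finite range. *)
Definition omit (i : nat) c (k : nat) := c (bump i k).

(** The label [d k] belongs to the edge from [c k] to [c k.+1], so omitting vertex [i] joins edges
    [i - 1] and [i]. For the last face [i = n.+1] the product lands at position [n], outside the [n]
    labels that remain, hence that face just drops a label. *)
Definition merge_at (i : nat) d (k : nat) : E :=
  if i is i'.+1 then
    if (k < i')%N then d k else if k == i' then mul (d i') (d i'.+1) else d k.+1
  else d k.+1.

Definition prism (rho : Gam -> Gam) (j : nat) c (k : nat) : Gam :=
  if (k <= j)%N then c k else rho (c k.-1).

Definition insert1 (j : nat) d (k : nat) : E :=
  if (k < j)%N then d k else if k == j then one else d k.-1.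

Lemma omit_omit i j c : (i < j)%N -> omit i (omit j c) = omit j.-1 (omit i c).
Proof. by move=> ij; apply/funext => k; rewrite /omit; congr c; rewrite /bump; lia. Qed.

Lemma merge_merge i j d : (i < j)%N -> merge_at i (merge_at j d) = merge_at j.-1 (merge_at i d).
Proof.
case: j => // j ij; apply/funext => k; case: i ij => [|i] ij; case: j ij => [|j] ij //=;
  by reindex.
Qed.

Lemma omit_prism_lt rho i j c : (i < j)%N ->
  omit i (prism rho j c) = prism rho j.-1 (omit i c).
Proof.
move=> ij; apply/funext => k; rewrite /omit /prism /bump.
by reindex.
Qed.

Lemma omit_prism_gt rho i j c : (j.+1 < i)%N ->
  omit i (prism rho j c) = prism rho j (omit i.-1 c).
Proof.
move=> ij; apply/funext => k; rewrite /omit /prism /bump.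
by reindex.
Qed.

(** Both sides are [c_0, ..., c_j, rho c_(j+1), ...], the face shared by two consecutive prisms. *)
Lemma omit_prism_diag rho j c :
  omit j.+1 (prism rho j.+1 c) = omit j.+1 (prism rho j c).
Proof.
apply/funext => k; rewrite /omit /prism /bump.
by reindex.
Qed.

Lemma merge_insert1_lt i j d : (i < j)%N ->
  merge_at i (insert1 j d) = insert1 j.-1 (merge_at i d).
Proof.
move=> ij; apply/funext => k; rewrite /merge_at /insert1; case: i ij => [|i] ij;
  by reindex.
Qed.

Lemma merge_insert1_gt i j d : (j.+1 < i)%N ->
  merge_at i (insert1 j d) = insert1 j (merge_at i.-1 d).
Proof.
case: i => // -[|i] // ij; apply/funext => k; rewrite /merge_at /insert1 /=.
by reindex.
Qed.

Lemma merge_insert1_diag j d :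
  merge_at j.+1 (insert1 j.+1 d) = merge_at j.+1 (insert1 j d).
Proof.
apply/funext => k; rewrite /merge_at /insert1.
by reindex.
Qed.

(** * Cofaces, the homogeneous differential and the prism homotopy *)

Section Cofaces.
Variables (A : zmodType) (aD : E -> A -> A).
Hypothesis aD1 : forall a, aD one a = a.
Hypothesis aDM : forall x y a, aD (mul x y) a = aD x (aD y a).
Hypothesis aDD : forall x a b, aD x (a + b) = aD x a + aD x b.
Implicit Types Phi Psi : (nat -> Gam) -> (nat -> E) -> A.

Lemma additive0 (f : A -> A) : {morph f : a b / a + b} -> f 0 = 0.
Proof. by move=> fD; apply: (addIr (f 0)); rewrite -fD !add0r. Qed.

Lemma additive_sum (f : A -> A) (fD : {morph f : a b / a + b}) I (s : seq I) (g : I -> A) :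
  f (\sum_(j <- s) g j) = \sum_(j <- s) f (g j).
Proof. by elim/big_rec2: _ => [|j x y _ <-]; rewrite ?additive0 ?fD. Qed.

Lemma additive_sgn (f : A -> A) (fD : {morph f : a b / a + b}) k a :
  f (sgn k a) = sgn k (f a).
Proof.
rewrite /sgn; case: odd => //; apply: (addIr (f a)).
by rewrite -fD !addNr additive0.
Qed.

(** The group part of the action in the 0-th term is absorbed by passing from base vertex [c 0] to
    [c 1]; only the action of the label [d 0] remains visible. *)
Definition coface (i : nat) Phi c d : A :=
  (if i is 0%N then aD (d 0%N) else id) (Phi (omit i c) (merge_at i d)).
Arguments coface : simpl never.

Definition hom_diff (n : nat) Phi c d : A := \sum_(i < n.+2) sgn i (coface i Phi c d).

Definition prism_op (rho : Gam -> Gam) (n : nat) Phi c d : A :=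
  \sum_(j < n) sgn j (Phi (prism rho j c) (insert1 j d)).

Lemma coface_sum I (s : seq I) (Phi : I -> (nat -> Gam) -> (nat -> E) -> A)
    (e : I -> nat) i c d :
  coface i (fun c d => \sum_(j <- s) sgn (e j) (Phi j c d)) c d =
  \sum_(j <- s) sgn (e j) (coface i (Phi j) c d).
Proof.
case: i => [|i] //; rewrite /coface additive_sum; last exact: aDD.
by apply: eq_bigr => j _; rewrite additive_sgn //; exact: aDD.
Qed.

(** The outer actions need care only for [(i, j) = (0, 1)], where the merged label [d 0 * d 1] acts
    on one side and its two factors act in succession on the other. *)
Lemma coface_coface i j Phi c d : (i < j)%N ->
  coface j (coface i Phi) c d = coface i (coface j.-1 Phi) c d.
Proof.
move=> ij; rewrite /coface omit_omit // merge_merge //.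
by case: i ij => [|i]; case: j => [|[|j]] //= _; rewrite -aDM.
Qed.

Lemma hom_diffK n Phi c d : hom_diff n.+1 (hom_diff n Phi) c d = 0.
Proof.
rewrite /hom_diff; under eq_bigr => j _.
  rewrite coface_sum sgn_sum.
  under eq_bigr do rewrite sgn_sgn.
  over.
by rewrite (simplicial_sum0 (a := fun j i => coface j (coface i Phi) c d)) // => i j /andP[ij _];
  rewrite coface_coface.
Qed.

Definition local n Phi := forall c c' d d',
  (forall k, (k <= n)%N -> c k = c' k) -> (forall k, (k < n)%N -> d k = d' k) ->
  Phi c d = Phi c' d'.

(** The two equations say that the [k]-th inhomogeneous entry [(d_k, c_k^-1 c_(k+1))] is the
    unit. *)
Definition hom_normalised n Phi := forall c d k,
  (k < n)%N -> d k = one -> c k = c k.+1 -> Phi c d = 0.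

(** The second summand is the differential of [prism_op rho n Phi], written as a sum over [n.+1]
    faces so that degree 0 is covered without a predecessor. *)
Lemma hom_diff_prism rho n Phi c d : local n Phi ->
  prism_op rho n.+1 (hom_diff n Phi) c d +
    \sum_(i < n.+1) sgn i (coface i (prism_op rho n Phi) c d) =
  Phi (rho \o c) d - Phi c d.
Proof.
move=> loc.
pose b j i := coface i Phi (prism rho j c) (insert1 j d).
pose e i j := coface i (fun c d => Phi (prism rho j c) (insert1 j d)) c d.
transitivity (\sum_(j < n.+1) \sum_(i < n.+2) sgn (j + i) (b j i) +
    \sum_(i < n.+1) \sum_(j < n) sgn (i + j) (e i j)).
  congr (_ + _); apply: eq_bigr => j _; last rewrite coface_sum; rewrite sgn_sum;
    by apply: eq_bigr => i _; rewrite sgn_sgn.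
rewrite prism_sum.
(* The two surviving faces: dropping vertex 0 of prism 0 leaves [rho \o c], the inserted unit acting
   trivially; dropping vertex [n.+1] of prism [n] leaves [c] and [d] only within the range that
   counts, whence locality. *)
- congr (_ - _); first by rewrite /b /coface /= aD1.
  apply: loc => k kn; rewrite /omit /prism /merge_at /insert1 /bump;
    repeat case: ifP; move=> *; first [exfalso; lia | congr_lia].
- move=> i j /andP[ij _]; rewrite /b /e /coface omit_prism_lt // merge_insert1_lt //.
  by case: i ij => // ij; rewrite /insert1 ij.
- move=> i j /andP[ij _]; rewrite /b /e /coface omit_prism_gt // merge_insert1_gt //.
  by case: i ij => // -[].
- by move=> j _; rewrite /b /coface omit_prism_diag merge_insert1_diag.
Qed.

Lemma hom_diff_local n Phi : local n Phi -> local n.+1 (hom_diff n Phi).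
Proof.
move=> loc c c' d d' Hc Hd; apply: eq_bigr => i _; congr sgn; rewrite /coface.
have -> : Phi (omit i c) (merge_at i d) = Phi (omit i c') (merge_at i d').
  apply: loc => k kn; first by apply: Hc; rewrite /bump; lia.
  case: (i : nat) => [|j] /=; first by apply: Hd; lia.
  case: ifP => _; first by apply: Hd; lia.
  by case: eqP => [kj|_]; rewrite !Hd //; lia.
by case: (i : nat) => //; rewrite Hd.
Qed.

Lemma prism_op_local rho n Phi : local n.+1 Phi -> local n (prism_op rho n.+1 Phi).
Proof.
move=> loc c c' d d' Hc Hd; apply: eq_bigr => j _; congr sgn.
have jn := ltn_ord j.
apply: loc => k kn; rewrite /prism /insert1.
  by case: ifP => kj; rewrite Hc //; lia.
by case: ifP => kj; [|case: ifP => // kj']; rewrite Hd //; lia.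
Qed.

(** A degenerate edge [k] stays degenerate in every prism: at position [k] if it precedes the
    inserted edge [j], at [k.+1] otherwise. So every summand vanishes. *)
Lemma prism_op_normalised rho n Phi :
  hom_normalised n.+1 Phi -> hom_normalised n (prism_op rho n.+1 Phi).
Proof.
move=> nrm c d k kn dk ck; rewrite /prism_op big1 // => j _.
case: (ltnP k j) => kj; rewrite (nrm _ _ (if (k < j)%N then k else k.+1)) ?sgn0 //;
  rewrite ?kj ?(leq_gtF kj) //.
- by lia.
- by rewrite /insert1 kj.
- by rewrite /prism kj (ltnW kj).
- by rewrite /insert1 !ifF //; lia.
- by rewrite /prism !ifF /= ?ck //; lia.
Qed.

(* The two faces adjacent to a degenerate entry coincide and have opposite signs. *)
Lemma hom_diff_normalised n Phi :
  hom_normalised n Phi -> hom_normalised n.+1 (hom_diff n Phi).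
Proof.
move=> nrm c d k kn dk ck; rewrite /hom_diff.
have kn1 : (k < n.+2)%N by lia.
have kn2 : (k.+1 < n.+2)%N by lia.
rewrite (bigD1 (Ordinal kn1)) //= (bigD1 (Ordinal kn2)) /=; last first.
  by rewrite -val_eqE /=; lia.
rewrite big1 ?addr0 => [|i]; last first.
  rewrite -!val_eqE /= => /andP[/eqP ik /eqP ik1].
  have -> : coface i Phi c d = 0; last by rewrite sgn0.
  rewrite /coface (nrm _ _ (if (i < k)%N then k.-1 else k)).
  - by case: (i : nat) => //; rewrite additive0 //; exact: aDD.
  - by case: ifP; have := ltn_ord i; lia.
  - case: ifP => ik2; rewrite /merge_at; case: (i : nat) ik ik1 ik2 => [|m] ? ? ?.
    + by rewrite prednK //; lia.
    + by rewrite !ifF ?prednK //; lia.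
    + by lia.
    + by rewrite ifT //; lia.
  - rewrite /omit /bump; case: ifP => ik2.
      have -> : (i <= k.-1)%N = true by lia.
      have -> : (i <= k.-1.+1)%N = true by lia.
      by rewrite !add1n prednK //; lia.
    have -> : (i <= k)%N = false by lia.
    by have -> : (i <= k.+1)%N = false by lia.
suff -> : coface k.+1 Phi c d = coface k Phi c d by rewrite sgnS addrN.
transitivity (Phi (omit k c) (merge_at k d)); last first.
  by rewrite /coface; case: k dk {kn kn1 kn2 ck} => // ->; rewrite aD1.
rewrite /coface; congr Phi; apply/funext => m.
  rewrite /omit /bump; have [mk|mk|mk] := ltngtP k m; rewrite ?add0n ?add1n //.
  by rewrite -mk.
rewrite /merge_at; case: k dk {kn kn1 kn2 ck} => [|k] dk.
  by rewrite ltn0 dk mul1l; case: eqP => // ->.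
have [mk|mk|->] := ltngtP m k.
- by rewrite ifT //; lia.
- by case: ifP => mk'; [lia|case: eqP => [->|//]; rewrite dk mul1l].
- by rewrite ltnSn dk mul1r.
Qed.
End Cofaces.
End Operators.

(** * Cochain complexes *)

Section Complexes.
Variables (X Y : rawcx) (f : forall n, cV X n -> cV Y n).
Hypotheses (cX : is_complex X) (cf : chain_map f).

Lemma chain_map0 n : f (0 : cV X n) = 0.
Proof.
have [X0 _] := cX n; have [fD _] := cf n.
by apply: (addIr (f (0 : cV X n))); rewrite -fD // !add0r.
Qed.

Lemma chain_map_bd n (x : cV X n) : is_bd x -> is_bd (f x).
Proof.
case: n x => [|n] x /= => [->|[w [Sw ->]]]; first exact: chain_map0.
by have [_ [fS fd]] := cf n; exists (f w); split; [exact: fS|exact: fd].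
Qed.

Lemma complex_d0 n : cd X n 0 = 0.
Proof.
have [X0 [_ [_ [dD _]]]] := cX n.
by apply: (addIr (cd X n 0)); rewrite -dD // !add0r.
Qed.

Lemma complex_dN n x : cS X n x -> cd X n (- x) = - cd X n x.
Proof.
have [_ [_ [SN [dD _]]]] := cX n => Sx.
by apply: (addIr (cd X n x)); rewrite -dD ?addNr ?complex_d0 //; exact: SN.
Qed.

Lemma complex_bd0 n : is_bd (0 : cV X n).
Proof.
case: n => [|n] //=; exists 0; split; first by case: (cX n).
by rewrite complex_d0.
Qed.

(** A left inverse [g] compatible with the differentials makes [f] injective on cohomology;
    surjectivity follows once [f \o g] is the identity up to boundaries on cocycles. *)
Lemma quasi_iso_of_retraction (g : forall n, cV Y n -> cV X n) :
  (forall n y, cS Y n y -> cS X n (g n y)) ->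
  (forall n y, cS Y n y -> g n.+1 (cd Y n y) = cd X n (g n y)) ->
  (forall n x, cS X n x -> g n (f x) = x) ->
  (forall n y, cS Y n y -> cd Y n y = 0 -> is_bd (y - f (g n y))) ->
  quasi_iso f.
Proof.
move=> gS gd gf hty.
(* No additivity of [g] is at hand, so [g 0 = 0] is read off from [g (f 0) = 0]. *)
have g0 n : g n 0 = 0 by rewrite -chain_map0 gf //; case: (cX n).
split=> // n; split=> [x Sx dx|y Sy dy]; last first.
  by exists (g n y); split; [exact: gS|split; [rewrite -gd // dy g0|exact: hty]].
case: n x Sx {dx} => [|n] x Sx /=; first by move=> fx0; rewrite -(gf _ _ Sx) fx0 g0.
by case=> w [Sw fxw]; exists (g n w); split; [exact: gS|rewrite -gd // -fxw gf].
Qed.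
End Complexes.

(** * Morphisms *)

Section Morphisms.
Variables (C : ConcCat) (F : LeftAdj C).
Hypothesis Ctop : topological F.
Implicit Types W X Y : Ob C.

(** The endomorphism of [F(pt)] sending the canonical point to [y] comes from a self-map of [unit],
    by full faithfulness. *)
Lemma Fo_unit_point (y : carr (Fo F unit)) : y = Defs.eta F tt.
Proof.
have [g [gM [gy _]]] := eta_univ F (fun _ : unit => y).
have [ff _] := Ctop; have [f [fE _]] := ff _ _ _ gM.
by rewrite -(gy tt) fE; case: (f tt).
Qed.

(** A constant map factors through [F(pt)], which is terminal and has a single point. *)
Lemma const_mor W X (x : carr X) : isMor (fun _ : carr W => x).
Proof.
have [_ [[Ft _] _]] := Ctop; have [t [tM _]] := Ft W.
have [g [gM [gx _]]] := eta_univ F (fun _ : unit => x).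
have := mor_comp tM gM; congr isMor; apply/funext => w.
by rewrite (Fo_unit_point (t w)) gx.
Qed.

Lemma pr1_mor X Y : isMor (@pr1 C X Y).
Proof. by case: (prod_univ X Y). Qed.

Lemma pr2_mor X Y : isMor (@pr2 C X Y).
Proof. by case: (prod_univ X Y) => _ []. Qed.

Lemma pair_mor W X Y (f : carr W -> carr X) (g : carr W -> carr Y) :
  isMor f -> isMor g ->
  exists h : carr W -> carr (prod X Y), isMor h /\ forall w, pr1 (h w) = f w /\ pr2 (h w) = g w.
Proof.
move=> fM gM; have [_ [_ H]] := prod_univ X Y.
by have [h [hM [hE _]]] := H _ _ _ fM gM; exists h.
Qed.

Lemma gmul_mor2 W (G : TopGroup C) (a b : carr W -> carr (gob G)) :
  isMor a -> isMor b -> isMor (fun w => gmul (a w) (b w)).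
Proof.
move=> aM bM; have [h [hM hE]] := pair_mor aM bM.
have := mor_comp hM (gmul_mor G); congr isMor; apply/funext => w.
by have [-> ->] := hE w.
Qed.

Lemma mmul_mor2 W (D : TopMonoid C) (a b : carr W -> carr (mob D)) :
  isMor a -> isMor b -> isMor (fun w => mmul (a w) (b w)).
Proof.
move=> aM bM; have [h [hM hE]] := pair_mor aM bM.
have := mor_comp hM (mmul_mor D); congr isMor; apply/funext => w.
by have [-> ->] := hE w.
Qed.

Lemma mktupleS T n (e : nat -> T) :
  [tuple e j | j < n.+1] = cons_tuple (e 0%N) [tuple e j.+1 | j < n].
Proof.
apply: eq_from_tnth => j; rewrite tnth_mktuple.
by case: (unliftP ord0 j) => [k ->|->]; rewrite ?tnthS ?tnth_mktuple ?tnth0.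
Qed.

(** The universal property of the iterated product, phrased through [coords]. *)
Lemma coords_lift W K1 K2 n (d : nat -> carr W -> carr K1) (c : nat -> carr W -> carr K2) :
  (forall k, isMor (d k)) -> (forall k, isMor (c k)) ->
  exists v : carr W -> carr (powK (prod K1 K2) n), isMor v /\
    forall w, coords (v w) = [tuple (d j w, c j w) | j < n].
Proof.
elim: n d c => [|n IH] d c dM cM.
  have [t [tM _]] := term_univ W; exists t; split=> // w.
  by rewrite [LHS]tuple0 [RHS]tuple0.
have [v [vM vE]] := IH _ _ (fun k => dM k.+1) (fun k => cM k.+1).
have [h [hM hE]] := pair_mor (dM 0%N) (cM 0%N).
have [u [uM uE]] := pair_mor hM vM.
exists u; split=> // w; rewrite (mktupleS _ (fun j => (d j w, c j w))) /=.
by have [-> ->] := uE w; have [-> ->] := hE w; rewrite vE.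
Qed.

(** An index out of range yields the constant default [e], still a morphism, so no bound on [k] is
    imposed. *)
Lemma nth_coords_mor K1 K2 (e : carr K1 * carr K2) n k :
  isMor (fun p : carr (powK (prod K1 K2) n) => (nth e (@coords C K1 K2 n p) k).1) /\
  isMor (fun p : carr (powK (prod K1 K2) n) => (nth e (@coords C K1 K2 n p) k).2).
Proof.
elim: n k => [|n IH] k; first split.
- by have := const_mor (@term C) e.1; congr isMor; apply/funext => p; rewrite nth_nil.
- by have := const_mor (@term C) e.2; congr isMor; apply/funext => p; rewrite nth_nil.
case: k => [|k].
  by split; [exact: (mor_comp (pr1_mor _ _) (pr1_mor _ _))
            |exact: (mor_comp (pr1_mor _ _) (pr2_mor _ _))].
have [M1 M2] := IH k.
by split; [exact: (mor_comp (pr2_mor _ _) M1)|exact: (mor_comp (pr2_mor _ _) M2)].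
Qed.

(** The point is the value at [eta F tt] of a lift, over [F(pt)], of constant families. *)
Lemma coords_surj K1 K2 n (x : n.-tuple (carr K1 * carr K2)) :
  exists p : carr (powK (prod K1 K2) n), @coords C K1 K2 n p = x.
Proof.
case: n x => [|n] x.
  have [t _] := term_univ (Fo F unit); exists (t (Defs.eta F tt)).
  by rewrite [LHS]tuple0 [RHS]tuple0.
have e := tnth x ord0.
have [v [_ vE]] := @coords_lift (Fo F unit) K1 K2 n.+1
  (fun j _ => (nth e x j).1) (fun j _ => (nth e x j).2)
  (fun j => const_mor _ _) (fun j => const_mor _ _).
exists (v (Defs.eta F tt)); rewrite vE; apply: eq_from_tnth => j.
by rewrite tnth_mktuple -surjective_pairing -tnth_nth.
Qed.
End Morphisms.

(** * Homogeneous cochains *)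

Section Homogeneous.
Variables (C : ConcCat) (F : LeftAdj C).
Hypothesis Ctop : topological F.
Variables (H : TopGroup C) (D : TopMonoid C) (A : zmodType).
Variables (act : carr (mob D) * carr (gob H) -> A -> A).
Variable hA : forall X : Ob C, (carr X -> A) -> Prop.
Hypothesis HA : module_rigid F (@mmul C D) (mone D) (@gmul C H) (gone H) act hA.

Lemma act1 a : act (mone D, gone H) a = a.
Proof. by case: HA => -[]. Qed.

Lemma actD k : {morph act k : a b / a + b}.
Proof. by case: HA => -[_ [_ h]] _; exact: h. Qed.

Lemma actM d h d' h' a : act (mmul d d', gmul h h') a = act (d, h) (act (d', h') a).
Proof. by case: HA => -[_ [h1 _]] _; rewrite -h1. Qed.

Lemma act0 k : act k 0 = 0.
Proof. exact: additive0 (actD k). Qed.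

Definition actl d := act (d, gone H).
Definition actr h := act (mone D, h).

Lemma actlM d d' a : actl (mmul d d') a = actl d (actl d' a).
Proof. by rewrite /actl -actM gmul1l. Qed.

Lemma actrM h h' a : actr (gmul h h') a = actr h (actr h' a).
Proof. by rewrite /actr -actM mmul1l. Qed.

Lemma actlr d h a : actl d (actr h a) = act (d, h) a.
Proof. by rewrite /actl /actr -actM mmul1r gmul1l. Qed.

Lemma actrl d h a : actr h (actl d a) = act (d, h) a.
Proof. by rewrite /actl /actr -actM mmul1l gmul1r. Qed.

Lemma hA0 X : hA (fun _ : carr X => 0).
Proof. by case: HA => _ [[h _] _]. Qed.

Lemma hAB X (f g : carr X -> A) : hA f -> hA g -> hA (fun x => f x - g x).
Proof. by case: HA => _ [[_ [h _]] _]; apply: h. Qed.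

Lemma hA_comp X Y (u : carr X -> carr Y) (f : carr Y -> A) :
  isMor u -> hA f -> hA (fun x => f (u x)).
Proof. by case: HA => _ [[_ [_ [h _]]] _] uM; apply: h. Qed.

Lemma hAN X (f : carr X -> A) : hA f -> hA (fun x => - f x).
Proof.
by move=> /(hAB (hA0 X)); congr hA; apply/funext => x; rewrite sub0r.
Qed.

Lemma hAD X (f g : carr X -> A) : hA f -> hA g -> hA (fun x => f x + g x).
Proof.
by move=> hf /hAN /(hAB hf); congr hA; apply/funext => x; rewrite opprK.
Qed.

Lemma hA_sgn X k (f : carr X -> A) : hA f -> hA (fun x => sgn k (f x)).
Proof. by rewrite /sgn; case: odd => //; exact: hAN. Qed.

Lemma hA_sum X n (f : 'I_n -> carr X -> A) :
  (forall j, hA (f j)) -> hA (fun x => \sum_(j < n) f j x).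
Proof.
elim: n f => [|n IH] f hf.
  by have := hA0 X; congr hA; apply/funext => x; rewrite big_ord0.
have := hAD (IH _ (fun j => hf (widen_ord (leqnSn n) j))) (hf ord_max).
by congr hA; apply/funext => x; rewrite big_ord_recr.
Qed.

Lemma hA_act X (d : carr X -> carr (mob D)) (h : carr X -> carr (gob H)) (f : carr X -> A) :
  isMor d -> isMor h -> hA f -> hA (fun x => act (d x, h x) (f x)).
Proof.
move=> dM hM hf; have [_ [_ ract]] := HA.
have [u [uM uE]] := pair_mor dM hM.
have [v [vM vE]] := pair_mor uM (mor_id X).
have := hA_comp vM (ract _ _ hf); congr hA; apply/funext => x.
by have [-> ->] := vE x; have [-> ->] := uE x.
Qed.

(** * The complex of homogeneous cochains *)

Section Coefficients.
Variables (Gam : TopGroup C) (j : carr (gob H) -> carr (gob Gam)).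
Local Notation cochain := ((nat -> carr (gob Gam)) -> (nat -> carr (mob D)) -> A).
Implicit Types Phi Psi : cochain.

Definition hom_rigid Phi := forall W (c : nat -> carr W -> carr (gob Gam))
    (d : nat -> carr W -> carr (mob D)),
  (forall k, isMor (c k)) -> (forall k, isMor (d k)) ->
  hA (fun w => Phi (c^~ w) (d^~ w)).

Definition equivariant Phi := forall h c d,
  Phi (fun k => gmul (j h) (c k)) d = actr h (Phi c d).

Definition hom_cochain n Phi :=
  [/\ local n Phi, hom_normalised (mone D) n Phi, hom_rigid Phi & equivariant Phi].

(** One construction serves both sides: [j = i] gives the cochains with values in the induced
    module, [j = id] those with values in [A]. *)
Definition hom_cx : rawcx :=
  {| cV := fun n => (cochain : zmodType);
     cS := hom_cochain;
     cd := hom_diff (@mmul C D) actl |}.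

Lemma hom_rigid_coface i Phi : hom_rigid Phi -> hom_rigid (coface (@mmul C D) actl i Phi).
Proof.
move=> rig W c d cM dM.
have hP : hA (fun w => Phi (omit i (c^~ w)) (merge_at (@mmul C D) i (d^~ w))).
  apply: (rig _ (fun k => c (bump i k)) (fun k w => merge_at (@mmul C D) i (d^~ w) k)) => k //.
  rewrite /merge_at; case: i => [|i] //; case: (k < i)%N => //; case: (k == i) => //.
  exact: mmul_mor2.
case: i hP => [|i] //; rewrite /coface; apply: hA_act; first exact: dM.
exact: const_mor Ctop _ _ _.
Qed.

Lemma equivariant_coface i Phi :
  equivariant Phi -> equivariant (coface (@mmul C D) actl i Phi).
Proof.
by move=> eqv h c d; case: i => [|i]; rewrite /coface /omit eqv // actlr actrl.
Qed.

Lemma hom_cochain_diff n Phi :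
  hom_cochain n Phi -> hom_cochain n.+1 (hom_diff (@mmul C D) actl n Phi).
Proof.
case=> loc nrm rig eqv; split.
- exact: hom_diff_local.
- apply: hom_diff_normalised => //; [exact: mmul1l|exact: mmul1r|exact: act1|].
  by move=> x; exact: actD.
- move=> W c d cM dM; apply: hA_sum => k; apply: hA_sgn.
  exact: (hom_rigid_coface k rig cM dM).
- move=> h c d; rewrite /hom_diff additive_sum; last exact: actD.
  apply: eq_bigr => k _; rewrite additive_sgn; last exact: actD.
  by rewrite (equivariant_coface _ eqv).
Qed.

Lemma hom_cochain0 n : hom_cochain n 0.
Proof.
split=> //; first by move=> W c d _ _; exact: hA0.
by move=> h c d; rewrite [RHS]act0.
Qed.

Lemma hom_cochainD n Phi Psi :
  hom_cochain n Phi -> hom_cochain n Psi -> hom_cochain n (Phi + Psi).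
Proof.
case=> loc nrm rig eqv [loc' nrm' rig' eqv']; split.
- by move=> c c' d d' cc dd; congr (_ + _); [exact: loc|exact: loc'].
- move=> c d k kn dk ck; rewrite -[RHS]addr0.
  by congr (_ + _); [exact: nrm kn dk ck|exact: nrm' kn dk ck].
- by move=> W c d cM dM; apply: hAD; [exact: rig|exact: rig'].
- by move=> h c d; rewrite [RHS]actD; congr (_ + _); [exact: eqv|exact: eqv'].
Qed.

Lemma hom_cochainN n Phi : hom_cochain n Phi -> hom_cochain n (- Phi).
Proof.
case=> loc nrm rig eqv; split.
- by move=> c c' d d' cc dd; congr (- _); exact: loc.
- by move=> c d k kn dk ck; rewrite -[RHS]oppr0; congr (- _); exact: nrm kn dk ck.
- by move=> W c d cM dM; apply: hAN; exact: rig.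
- move=> h c d; apply: etrans (esym (additive_sgn (actD _) 1 (Phi c d))).
  by congr (- _); exact: eqv.
Qed.

Lemma hom_diffD n Phi Psi :
  hom_diff (@mmul C D) actl n (Phi + Psi) =
  hom_diff (@mmul C D) actl n Phi + hom_diff (@mmul C D) actl n Psi.
Proof.
apply/funext => c; apply/funext => d.
rewrite -[RHS]/(hom_diff _ _ _ _ c d + hom_diff _ _ _ _ c d) /hom_diff -big_split.
apply: eq_bigr => k _; apply: etrans _ (sgnD _ _ _); congr sgn.
by rewrite /coface; case: (k : nat) => [|i] //; exact: actD.
Qed.

Lemma hom_cx_complex : is_complex hom_cx.
Proof.
move=> n; split; first exact: hom_cochain0.
split; first by move=> x y; exact: hom_cochainD.
split; first by move=> x; exact: hom_cochainN.
split; first by move=> x y _ _; exact: hom_diffD.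
split; first by move=> x; exact: hom_cochain_diff.
move=> x _; apply/funext => c; apply/funext => d.
by apply: hom_diffK; [exact: mmulA|exact: actlM|move=> k; exact: actD].
Qed.

Lemma hom_cochain_prism (rho : carr (gob Gam) -> carr (gob Gam)) n Phi :
  isMor rho -> (forall h g, rho (gmul (j h) g) = gmul (j h) (rho g)) ->
  hom_cochain n.+1 Phi -> hom_cochain n (prism_op (mone D) rho n.+1 Phi).
Proof.
move=> rhoM rho_eqv [loc nrm rig eqv]; split.
- exact: prism_op_local.
- exact: prism_op_normalised.
- move=> W c d cM dM; apply: hA_sum => m; apply: hA_sgn.
  apply: (rig _ (fun k w => prism rho m (c^~ w) k)
                (fun k w => insert1 (mone D) m (d^~ w) k)) => k.
    by rewrite /prism; case: (k <= m)%N => //; exact: (mor_comp (cM _) rhoM).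
  by rewrite /insert1; case: (k < m)%N => //; case: (k == m) => //; exact: const_mor Ctop _ _ _.
- move=> h c d; rewrite /prism_op additive_sum; last exact: actD.
  apply: eq_bigr => m _; rewrite additive_sgn; last exact: actD.
  congr sgn; rewrite -[RHS]eqv; congr Phi; apply/funext => k.
  by rewrite /prism; case: ifP => _ //; rewrite rho_eqv.
Qed.

Lemma hom_cx_homotopy (rho : carr (gob Gam) -> carr (gob Gam)) n (Phi : cV hom_cx n) :
  isMor rho -> (forall h g, rho (gmul (j h) g) = gmul (j h) (rho g)) ->
  cS hom_cx n Phi -> cd hom_cx n Phi = 0 ->
  is_bd (Phi - (fun c d => Phi (rho \o c) d) : cV hom_cx n).
Proof.
move=> rhoM rhoE S dPhi0.
have hty c d : \sum_(k < n.+1) sgn k (coface (@mmul C D) actl k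
    (prism_op (mone D) rho n Phi) c d) = Phi (rho \o c) d - Phi c d.
  have [loc _ _ _] := S.
  rewrite -(hom_diff_prism (@mmul1l _ D) (@mmul1r _ D) act1
    (fun x => actD (x, gone H)) rho c d loc) [hom_diff _ _ _ _]dPhi0.
  by rewrite [X in _ = X + _]big1 ?add0r // => k _; exact: sgn0.
(* In degree 0 the prism sum is empty and boundaries are zero, so the identity [hty] directly gives
   equality. *)
case: n Phi S {dPhi0} hty => [|n] Phi S hty /=.
  apply/funext => c; apply/funext => d; rewrite -[LHS]/(Phi c d - Phi (rho \o c) d).
  by rewrite -opprB -hty big_ord1 /= /coface /prism_op big_ord0 [actl _ _]act0 /sgn oppr0.
(* The sign is needed because [hty] computes [Phi (rho \o c) d - Phi c d], the opposite of the class
   in question. *)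
exists (- prism_op (mone D) rho n.+1 Phi); split.
  exact/hom_cochainN/hom_cochain_prism.
rewrite -[hom_diff _ _ _ _]/(cd hom_cx n _) (complex_dN hom_cx_complex); last first.
  exact: hom_cochain_prism.
rewrite -[LHS]opprB; congr (- _).
by apply/funext => c; apply/funext => d; apply/esym/hty.
Qed.
End Coefficients.

Lemma hom_cochain_pullback (Gam Gam' : TopGroup C) (j : carr (gob H) -> carr (gob Gam))
    (j' : carr (gob H) -> carr (gob Gam')) (s : carr (gob Gam) -> carr (gob Gam')) n Phi :
  isMor s -> (forall h g, s (gmul (j h) g) = gmul (j' h) (s g)) ->
  hom_cochain j' n Phi -> hom_cochain j n (fun c d => Phi (s \o c) d).
Proof.
move=> sM sE [loc nrm rig eqv]; split.
- by move=> c c' d d' cc dd; apply: loc => // k kn /=; rewrite cc.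
- by move=> c d k kn dk ck; apply: nrm kn dk _ => /=; rewrite ck.
- move=> W c d cM dM; apply: (rig _ (fun k w => s (c k w))) => // k.
  exact: (mor_comp (cM k) sM).
- move=> h c d; rewrite -eqv; congr Phi; apply/funext => k; exact: sE.
Qed.

(** * Inhomogeneous coordinates *)

Section Coordinates.
Variable Gam : TopGroup C.
Local Notation T := (carr (mob D) * carr (gob Gam))%type.
Local Notation one := (mone D, gone Gam).
Local Notation mul := (pair_mul (@mmul C D) (@gmul C Gam)).
Implicit Types (c : nat -> carr (gob Gam)) (d : nat -> carr (mob D)) (g : carr (gob Gam)).

Definition steps n c d : n.-tuple T :=
  [tuple (d k, gmul (ginv (c k)) (c k.+1)) | k < n].

Fixpoint partial_mul g (u : nat -> T) (k : nat) : carr (gob Gam) :=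
  if k is k'.+1 then gmul (partial_mul g u k') (u k').2 else g.

(** The vertices [g, g x_0, g x_0 x_1, ...] built from the group components; together with [labels]
    this inverts [steps] once the base vertex [g] is given. *)
Definition verts n g (x : n.-tuple T) := partial_mul g (nth one x).
Definition labels n (x : n.-tuple T) (k : nat) := (nth one x k).1.

Lemma gmulKV g g' : gmul g (gmul (ginv g) g') = g'.
Proof. by rewrite gmulA gmulVr gmul1l. Qed.

Lemma gmulVK g g' : gmul (ginv g) (gmul g g') = g'.
Proof. by rewrite gmulA gmulVl gmul1l. Qed.

Lemma gmul_step g a b : gmul (ginv (gmul g a)) (gmul g b) = gmul (ginv a) b.
Proof.
rewrite -{1}[b](gmulKV a) [gmul g (gmul a _)]gmulA gmulA.
by rewrite gmulVl gmul1l.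
Qed.

Lemma nth_mktuple_lt S n (s : S) (e : nat -> S) k :
  (k < n)%N -> nth s [tuple e l | l < n] k = e k.
Proof. by move=> kn; rewrite -[k]/(val (Ordinal kn)) -tnth_nth tnth_mktuple. Qed.

Lemma nth_steps n c d k : (k < n)%N ->
  nth one (steps n c d) k = (d k, gmul (ginv (c k)) (c k.+1)).
Proof. exact: (nth_mktuple_lt _ (fun k => (d k, gmul (ginv (c k)) (c k.+1)))). Qed.

Lemma eq_steps n c c' d d' :
  (forall k, (k < n)%N -> d k = d' k) ->
  (forall k, (k < n)%N -> gmul (ginv (c k)) (c k.+1) = gmul (ginv (c' k)) (c' k.+1)) ->
  steps n c d = steps n c' d'.
Proof.
by move=> dd cc; apply: eq_from_tnth => k; rewrite !tnth_mktuple dd ?cc.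
Qed.

Lemma verts_steps n c d k : (k <= n)%N -> verts (c 0%N) (steps n c d) k = c k.
Proof.
elim: k => // k IH kn.
rewrite -[LHS]/(gmul (verts _ _ k) (nth one (steps n c d) k).2) IH; last exact: ltnW.
by rewrite nth_steps //= gmulKV.
Qed.

Lemma labels_steps n c d k : (k < n)%N -> labels (steps n c d) k = d k.
Proof. by move=> kn; rewrite /labels nth_steps. Qed.

Lemma steps_verts n g (x : n.-tuple T) : steps n (verts g x) (labels x) = x.
Proof.
apply: eq_from_tnth => k; rewrite tnth_mktuple /= gmulVK -surjective_pairing.
by rewrite -tnth_nth.
Qed.

Lemma gmul_verts n g g' (x : n.-tuple T) k :
  gmul g (verts g' x k) = verts (gmul g g') x k.
Proof. by elim: k => //= k IH; rewrite gmulA [gmul g _]IH. Qed.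

Lemma face0_steps n c d :
  face0 one (steps n.+1 c d) = steps n (omit 0 c) (merge_at (@mmul C D) 0 d).
Proof. by apply: eq_from_tnth => k; rewrite !tnth_mktuple nth_steps // ltnS. Qed.

(** The index shifts by one: multiplying entries [i] and [i.+1] telescopes through [c i.+1], which
    is therefore the vertex omitted. *)
Lemma facem_steps n i c d : (i < n)%N ->
  facem mul one i (steps n.+1 c d) = steps n (omit i.+1 c) (merge_at (@mmul C D) i.+1 d).
Proof.
move=> lt_in; apply: eq_from_tnth => k; have kn := ltn_ord k.
rewrite !tnth_mktuple /omit /merge_at /bump.
have [ki|ki|ki] := ltngtP k i.
- rewrite nth_steps; last lia.
  by have -> : (i < k.+1)%N = false by lia.
- rewrite nth_steps //; have -> : (i < k.+1)%N = true by lia.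
  by rewrite !add1n.
- rewrite !nth_steps //; try lia.
  rewrite ki ltnSn add0n add1n /pair_mul /=; congr (_, _).
  by rewrite -gmulA gmulKV.
Qed.

Lemma facel_steps n c d :
  facel one (steps n.+1 c d) = steps n (omit n.+1 c) (merge_at (@mmul C D) n.+1 d).
Proof.
apply: eq_from_tnth => k; have kn := ltn_ord k.
rewrite !tnth_mktuple nth_steps; last lia.
rewrite /omit /merge_at /bump kn.
have -> : (n < k)%N = false by lia.
by have -> : (n < k.+1)%N = false by lia.
Qed.

Lemma steps_one n c d :
  (exists k : 'I_n, tnth (steps n c d) k = one) ->
  exists2 k, (k < n)%N & d k = mone D /\ c k = c k.+1.
Proof.
case=> k; rewrite tnth_mktuple => -[dk ck]; exists k => //; split=> //.
by rewrite -[RHS](gmulKV (c k)) ck gmul1r.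
Qed.

Lemma coords_mor n :
  (forall k, isMor (fun p => labels (@coords C (mob D) (gob Gam) n p) k)) /\
  forall W (g : carr W -> carr (gob Gam)) (u : carr W -> carr (powK (prod (mob D) (gob Gam)) n)),
    isMor g -> isMor u -> forall k, isMor (fun w => verts (g w) (coords (u w)) k).
Proof.
split=> [k|W g u gM uM]; first by have [] := nth_coords_mor Ctop one n k.
elim=> [|k IH] //; apply: gmul_mor2 => //.
by have [_] := nth_coords_mor Ctop one n k; exact: mor_comp.
Qed.
End Coordinates.

(** * Comparison with cochains valued in the induced module *)

Section Induced.
Variables (G : TopGroup C) (i : carr (gob H) -> carr (gob G)).
Local Notation T := (carr (mob D) * carr (gob G))%type.

Definition hom_of_ind n (f : n.-tuple T -> carr (gob G) -> A)
    (c : nat -> carr (gob G)) (d : nat -> carr (mob D)) : A :=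
  f (steps n c d) (c 0%N).

Definition ind_of_hom n (Phi : (nat -> carr (gob G)) -> (nat -> carr (mob D)) -> A)
    (x : n.-tuple T) (g : carr (gob G)) : A :=
  Phi (verts g x) (labels x).

Lemma ind_of_homK n Phi : local n Phi -> hom_of_ind (@ind_of_hom n Phi) = Phi.
Proof.
move=> loc; apply/funext => c; apply/funext => d; apply: loc => k kn.
  exact: verts_steps.
exact: labels_steps.
Qed.

Lemma hom_of_indK n (f : n.-tuple T -> carr (gob G) -> A) : ind_of_hom (hom_of_ind f) = f.
Proof.
by apply/funext => x; apply/funext => g; rewrite /ind_of_hom /hom_of_ind steps_verts.
Qed.

(** The terms match one by one. In the 0-th, translating by [c_0^-1 c_1] and evaluating at [c_0] is
    evaluation at [c_1]. *)
Lemma hom_of_ind_cobound n (f : n.-tuple T -> carr (gob G) -> A) :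
  hom_of_ind (cd (cx_Ind F i act hA) n f) = hom_diff (@mmul C D) actl n (hom_of_ind f).
Proof.
apply/funext => c; apply/funext => d; rewrite /hom_of_ind /= /cobound.
have sgnE k (b : carr (gob G) -> A) g : sgn k b g = sgn k (b g).
  by rewrite /sgn; case: odd.
rewrite /hom_diff big_ord_recl big_ord_recr /= addrA.
rewrite -[LHS]/(_ + _ + _); congr (_ + _ + _).
- by rewrite /actInd nth_steps //= gmulKV face0_steps.
- by rewrite fct_sumE; apply: eq_bigr => k _; rewrite sgnE facem_steps.
- by rewrite sgnE facel_steps.
Qed.

Lemma hom_cochain_of_ind n f :
  cS (cx_Ind F i act hA) n f -> hom_cochain i n (hom_of_ind f).
Proof.
case=> -[fB [rig eqv]] nrm; split.
- move=> c c' d d' cc dd; rewrite /hom_of_ind cc //; congr f.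
  by apply: eq_steps => // k kn; rewrite !cc //; lia.
- move=> c d k kn dk ck; rewrite /hom_of_ind nrm //.
  by exists (Ordinal kn); rewrite tnth_mktuple /= dk ck gmulVl.
- move=> W c d cM dM.
  have sM k : isMor (fun w => gmul (ginv (c k w)) (c k.+1 w)).
    by apply: gmul_mor2 => //; exact: (mor_comp (cM k) (ginv_mor G)).
  have [v [vM vE]] := coords_lift n dM sM.
  have [u [uM uE]] := pair_mor vM (cM 0%N).
  have := hA_comp uM rig; congr hA; apply/funext => w.
  by have [-> ->] := uE w; rewrite vE.
- move=> h c d; rewrite /hom_of_ind.
  have -> : steps n (fun k => gmul (i h) (c k)) d = steps n c d.
    by apply: eq_steps => // k kn; rewrite gmul_step.
  (* The equivariance in [fB] speaks of points of the power object and of [F(pt) x G], so points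
     with the required coordinates are produced first. *)
  have [p <-] := coords_surj Ctop (steps n c d).
  have [_] := fB p.
  have pt g : exists q : carr (prod (Fo F unit) (gob G)), pr2 q = g /\ pr1 q = Defs.eta F tt.
    have [u [_ uE]] := pair_mor (mor_id (Fo F unit)) (const_mor Ctop (Fo F unit) g).
    by exists (u (Defs.eta F tt)); have [] := uE (Defs.eta F tt).
  have [q [q2 q1]] := pt (c 0%N); have [q' [q'2 q'1]] := pt (gmul (i h) (c 0%N)).
  move=> /(_ q q' h); rewrite q2 q'2; apply=> //.
  by rewrite q1.
Qed.

Lemma ind_of_hom_cochain n Phi :
  hom_cochain i n Phi -> cS (cx_Ind F i act hA) n (@ind_of_hom n Phi).
Proof.
case=> loc nrm rig eqv.
have eqvI x g h : @ind_of_hom n Phi x (gmul (i h) g) = actr h (ind_of_hom Phi x g).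
  by rewrite /ind_of_hom -eqv; congr Phi; apply/funext => k; rewrite gmul_verts.
split; first split.
(* First each single value lies in the induced module, with the labels constant; the next bullet
   treats dependence on all coordinates jointly. *)
- move=> p; split=> [|q q' h _ ->]; last exact: eqvI.
  apply: (rig _ (fun k q => verts (pr2 q) (coords p) k) (fun k _ => labels (coords p) k)) => k.
    have [_] := coords_mor G n; apply; first exact: pr2_mor.
    exact: const_mor Ctop _ _ _.
  exact: const_mor Ctop _ _ _.
- split=> [|q q' h -> ->]; last exact: eqvI.
  have [labM vertM] := coords_mor G n.
  apply: (rig _ (fun k q => verts (pr2 q) (coords (pr1 q)) k)
                (fun k q => labels (coords (pr1 q)) k)) => k.
    by apply: vertM; [exact: pr2_mor|exact: pr1_mor].
  exact: (mor_comp (pr1_mor _ _) (labM k)).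
- move=> x xone; apply/funext => g.
  move: xone; rewrite -{1}(steps_verts g x) => /steps_one[k kn [dk ck]].
  exact: nrm kn dk ck.
Qed.

Lemma ind_of_hom_chain_map :
  @chain_map (hom_cx i) (cx_Ind F i act hA) (fun n Phi => @ind_of_hom n Phi).
Proof.
move=> n; split=> //; split=> [Phi S|Phi S]; first exact: ind_of_hom_cochain.
(* As [ind_of_hom] inverts [hom_of_ind], its compatibility with differentials is inherited from that
   of the inverse. *)
rewrite -[RHS]hom_of_indK hom_of_ind_cobound ind_of_homK //.
by case: S.
Qed.
End Induced.

(** * Comparison with cochains valued in [A] *)

Section Plain.
Local Notation T := (carr (mob D) * carr (gob H))%type.

Definition hom_of_cochain n (f : n.-tuple T -> A)
    (c : nat -> carr (gob H)) (d : nat -> carr (mob D)) : A :=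
  actr (c 0%N) (f (steps n c d)).

Definition cochain_of_hom n (Phi : (nat -> carr (gob H)) -> (nat -> carr (mob D)) -> A)
    (x : n.-tuple T) : A :=
  Phi (verts (gone H) x) (labels x).

(** Passing to [cochain_of_hom] normalises the base vertex to 1; equivariance lets the factor [c 0]
    translate it back. *)
Lemma cochain_of_homK n Phi : hom_cochain id n Phi ->
  hom_of_cochain (@cochain_of_hom n Phi) = Phi.
Proof.
case=> loc _ _ eqv; apply/funext => c; apply/funext => d.
rewrite /hom_of_cochain -eqv; apply: loc => k kn; last exact: labels_steps.
by rewrite gmul_verts gmul1r verts_steps.
Qed.

Lemma hom_of_cochainK n (f : n.-tuple T -> A) : cochain_of_hom (hom_of_cochain f) = f.
Proof.
by apply/funext => x; rewrite /cochain_of_hom /hom_of_cochain steps_verts [LHS]act1.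
Qed.

Lemma hom_of_cochain_cobound n (f : n.-tuple T -> A) :
  hom_of_cochain (cd (cx_A act hA) n f) = hom_diff (@mmul C D) actl n (hom_of_cochain f).
Proof.
apply/funext => c; apply/funext => d; rewrite /hom_of_cochain /= /cobound.
have aD : {morph actr (c 0%N) : a b / a + b} by exact: actD.
rewrite /hom_diff big_ord_recl big_ord_recr /= addrA !aD.
congr (_ + _ + _).
(* Here [c_0] applied after [(d_0, c_0^-1 c_1)] is the action of [(d_0, c_1)]. *)
- by rewrite /coface /= actlr nth_steps // face0_steps {1}/actr -actM mmul1l gmulKV.
- rewrite additive_sum; last exact: actD.
  by apply: eq_bigr => k _; rewrite facem_steps // additive_sgn //; exact: actD.
- by rewrite facel_steps additive_sgn //; exact: actD.
Qed.

Lemma hom_cochain_of_cochain n f :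
  cS (cx_A act hA) n f -> hom_cochain id n (hom_of_cochain f).
Proof.
case=> rig nrm; split.
- move=> c c' d d' cc dd; rewrite /hom_of_cochain cc //; congr (actr _ (f _)).
  by apply: eq_steps => // k kn; rewrite !cc //; lia.
- move=> c d k kn dk ck; rewrite /hom_of_cochain nrm ?[LHS]act0 //.
  by exists (Ordinal kn); rewrite tnth_mktuple /= dk ck gmulVl.
- move=> W c d cM dM.
  have sM k : isMor (fun w => gmul (ginv (c k w)) (c k.+1 w)).
    by apply: gmul_mor2 => //; exact: (mor_comp (cM k) (ginv_mor H)).
  have [v [vM vE]] := coords_lift n dM sM.
  apply: hA_act => //; first exact: const_mor Ctop _ _ _.
  by have := hA_comp vM rig; congr hA; apply/funext => w; rewrite vE.
- move=> h c d; rewrite /hom_of_cochain -actrM; congr (actr _ (f _)).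
  by apply: eq_steps => // k kn; rewrite gmul_step.
Qed.

Lemma cochain_of_hom_cochain n Phi :
  hom_cochain id n Phi -> cS (cx_A act hA) n (@cochain_of_hom n Phi).
Proof.
case=> loc nrm rig eqv; have [labM vertM] := coords_mor H n; split.
  apply: (rig _ (fun k p => verts (gone H) (coords p) k) (fun k p => labels (coords p) k)) => k //.
  by apply: vertM; [exact: const_mor Ctop _ _ _|exact: mor_id].
move=> x; rewrite -{1}(steps_verts (gone H) x) => /steps_one[k kn [dk ck]].
exact: nrm kn dk ck.
Qed.

Lemma cochain_of_hom_chain_map :
  @chain_map (hom_cx (@id (carr (gob H)))) (cx_A act hA) (fun n Phi => @cochain_of_hom n Phi).
Proof.
move=> n; split=> //; split=> [Phi S|Phi S]; first exact: cochain_of_hom_cochain.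
by rewrite -[RHS]hom_of_cochainK hom_of_cochain_cobound cochain_of_homK.
Qed.
End Plain.
End Homogeneous.

(** * The roof of quasi-isomorphisms *)

Theorem theorem12p1
  (C : ConcCat) (F : LeftAdj C) (Ctop : topological F)
  (G H : TopGroup C) (i : carr (gob H) -> carr (gob G)) (HsubG : topo_subgroup i)
  (r : carr (gob G) -> carr (gob H)) (Hr : H_retraction i r)
  (D : TopMonoid C)
  (Dab : forall x y : carr (mob D), mmul x y = mmul y x)
  (Ddisc : discrete (mob D))
  (A : zmodType) (act : carr (mob D) * carr (gob H) -> A -> A)
  (hA : forall X : Ob C, (carr X -> A) -> Prop)
  (HA : module_rigid F (@mmul C D) (mone D) (@gmul C H) (gone H) act hA)
  (Dpliant : pliant (mob D) hA) :
  derived_iso (cx_Ind F i act hA) (cx_A act hA).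
Proof.
have [iM [i_mul _]] := HsubG; have [rM [r1 r_mul]] := Hr.
have ri h : r (i h) = h by rewrite -[i h]gmul1r r_mul r1 gmul1r.
(* The apex of the roof consists of homogeneous cochains with vertices in [H]; one leg pulls back
   along [r], the other only changes coordinates. *)
pose Z := hom_cx act hA (@id (carr (gob H))).
have cZ : is_complex Z := hom_cx_complex Ctop HA (@id (carr (gob H))).
pose rpull (Phi : (nat -> carr (gob H)) -> (nat -> carr (mob D)) -> A) :=
  fun c d => Phi (r \o c) d.
pose ipull (Phi : (nat -> carr (gob G)) -> (nat -> carr (mob D)) -> A) :=
  fun c d => Phi (i \o c) d.
have rpullS n Phi : hom_cochain act hA id n Phi -> hom_cochain act hA i n (rpull Phi).
  by apply: hom_cochain_pullback.
have ipullS n Phi : hom_cochain act hA i n Phi -> hom_cochain act hA id n (ipull Phi).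
  by apply: hom_cochain_pullback.
pose X := cx_Ind F i act hA; pose Y := cx_A act hA.
pose to_ind n (Phi : cV Z n) : cV X n := ind_of_hom (rpull Phi).
pose of_ind n (f : cV X n) : cV Z n := ipull (hom_of_ind f).
pose to_A n (Phi : cV Z n) : cV Y n := cochain_of_hom Phi.
pose of_A n (f : cV Y n) : cV Z n := hom_of_cochain act f.
have cI := ind_of_hom_chain_map Ctop act hA i.
have cA : chain_map to_A := cochain_of_hom_chain_map Ctop HA.
exists Z; split=> //; exists to_ind, to_A; split.
  apply: (@quasi_iso_of_retraction Z X to_ind _ _ of_ind) => //; rewrite /to_ind /of_ind.
  - move=> n; have [_ [cIS cId]] := cI n; split=> //; split=> [Phi S|Phi S].
      exact: cIS (rpullS _ _ S).
    exact: (cId (rpull Phi) (rpullS _ _ S)).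
  - by move=> n f Sf; apply: ipullS; exact: (hom_cochain_of_ind Ctop HA Sf).
  - by move=> n f Sf; rewrite hom_of_ind_cobound.
  - move=> n Phi S; rewrite ind_of_homK; last by case: (rpullS _ _ S).
    apply/funext => c; apply/funext => d; rewrite /ipull /rpull; congr Phi.
    by apply/funext => k /=.
  (* The composite on the induced side is pullback along the equivariant map [i \o r], to which the
     prism homotopy applies. *)
  - move=> n f Sf df; have Sh := hom_cochain_of_ind Ctop HA Sf.
    have rhoM : isMor (fun g => i (r g)) by exact: mor_comp.
    have rhoE h g : i (r (gmul (i h) g)) = gmul (i h) (i (r g)) by rewrite r_mul i_mul.
    have dh : cd (hom_cx act hA i) n (hom_of_ind f) = 0.
      by rewrite /= -(hom_of_ind_cobound F act hA i) [cd _ _ _]df.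
    rewrite -{1}[f]hom_of_indK.
    exact: (chain_map_bd (hom_cx_complex Ctop HA i) cI
              (hom_cx_homotopy Ctop HA rhoM rhoE Sh dh)).
apply: (@quasi_iso_of_retraction Z Y to_A _ _ of_A) => //; rewrite /to_A /of_A.
- by move=> n f Sf; exact: (hom_cochain_of_cochain Ctop HA Sf).
- by move=> n f _; rewrite (hom_of_cochain_cobound HA).
- by move=> n Phi S; exact: (cochain_of_homK S).
(* This leg has a two-sided inverse, so the difference is zero, a trivial boundary. *)
- move=> n f Sf _; rewrite (hom_of_cochainK HA) subrr -(chain_map0 cZ cA).
  exact: (chain_map_bd cZ cA (complex_bd0 cZ n)).
Qed.
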